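(* Let $f_0,f_1$ be nominal densities, $l=f_1/f_0$, and consider the total variation neighborhoods $\mathscr G_0,\mathscr G_1$ of $F_0,F_1$ with radii $\epsilon_0$ and $\epsilon_1$, assumed disjoint. Then the robust likelihood ratio function is $$\hat l=\begin{cases}t_l,& l<t_l,\\ l,& t_l\le l\le t_u,\\ t_u,& l>t_u,\end{cases}$$ for thresholds $0<t_l<t_u<\infty$, and the corresponding least favorable distributions have the densities $$\hat g_0=\begin{cases}(1-\beta t_l)f_0+\beta f_1,& l<t_l,\\ f_0,& t_l\le l\le t_u,\\ (1-\sigma t_u)f_0+\sigma f_1,& l>t_u,\end{cases}\qquad \hat g_1=\begin{cases}t_l\,\hat g_0,& l<t_l,\\ f_1,& t_l\le l\le t_u,\\ t_u\,\hat g_0,& l>t_u,\end{cases}$$ where the coefficients $$\beta(t_l,t_u)=\frac{\epsilon_0}{\int_{l<t_l}(t_lf_0-f_1)\,d\mu},\qquad \sigma(t_l,t_u)=\frac{\epsilon_0}{\int_{l>t_u}(f_1-t_uf_0)\,d\mu}$$ are explicit functions of the clipping thresholds $t_l$ and $t_u$.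
   Context: $F_0,F_1$ are probability measures on $\Omega$ with densities $f_0,f_1$ with respect to a measure $\mu$. The total variation neighborhoods are $\mathscr G_j=\{G_j: D_{\mathrm{TV}}(G_j,F_j)\le\epsilon_j\}$, $j\in\{0,1\}$, where $D_{\mathrm{TV}}(G_j,F_j)=\frac12\int_\Omega|g_j-f_j|\,d\mu$ and $g_j$ is the density of the probability measure $G_j$. The radii $\epsilon_0,\epsilon_1$ need not be equal. For $u\in(0,1)$ let $D_u(G_0,G_1)=\int_\Omega g_1^ug_0^{1-u}\,d\mu$. The least favorable distributions $(\hat G_0,\hat G_1)$, with densities $(\hat g_0,\hat g_1)$, are the solution of $\min_{u\in(0,1)}\max_{(G_0,G_1)\in\mathscr G_0\times\mathscr G_1}D_u(G_0,G_1)$, i.e. they maximize $D_u$ over $\mathscr G_0\times\mathscr G_1$ for the minimizing $u$. The robust likelihood ratio function is $\hat l=\hat g_1/\hat g_0$. *)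

(* Defs.v *)
From HB Require Import structures.
From mathcomp Require Import all_boot all_order all_algebra.
From mathcomp Require Import all_classical all_reals all_analysis.

Set Implicit Arguments.
Unset Strict Implicit.
Unset Printing Implicit Defensive.

Import Order.TTheory GRing.Theory Num.Theory.
Import numFieldNormedType.Exports.

Local Open Scope classical_set_scope.
Local Open Scope ring_scope.

Section robust_testing.
Context {d : measure_display} {T : measurableType d} {R : realType}.
Variable mu : {measure set T -> \bar R}.

Implicit Types (P Q F G : probability T R) (f g : T -> R).

Definition is_density P f : Prop :=
  [/\ measurable_fun [set: T] f, (forall x, 0 <= f x) &
      forall A, measurable A -> P A = (\int[mu]_(x in A) (f x)%:E)%E].

(* [mu] need not be sigma-finite, so the Radon-Nikodym derivative of the library
   does not apply.  Densities are unique up to [mu]-null sets, and [density P]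
   is one of them; if [P] has no density it is the junk value 0. *)
Definition density P : T -> R := xget (cst 0) [set f | is_density P f].

Definition D_TV G F : \bar R :=
  ((2^-1)%:E * \int[mu]_x `|density G x - density F x|%:E)%E.

Definition tv_nbhd F (eps : R) : set (probability T R) :=
  [set G | (exists g, is_density G g) /\ (D_TV G F <= eps%:E)%E].

Definition D_ (u : R) G0 G1 : \bar R :=
  (\int[mu]_x (density G1 x `^ u * density G0 x `^ (1 - u))%:E)%E.

Section least_favorable.
Variables (N0 N1 : set (probability T R)).

Definition max_D (u : R) : \bar R :=
  ereal_sup [set D_ u G.1 G.2 | G in N0 `*` N1].

Definition minimizing (u : R) : Prop :=
  0 < u < 1 /\ forall v : R, 0 < v < 1 -> (max_D u <= max_D v)%E.

Definition least_favorable G0 G1 : Prop :=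
  exists u : R, [/\ minimizing u, N0 G0, N1 G1 &
    forall H0 H1, N0 H0 -> N1 H1 -> (D_ u H0 H1 <= D_ u G0 G1)%E].

End least_favorable.

(* The quotient is taken in [\bar R], where [a / 0 = +oo] for [0 < a]: the points
   with [f0 x = 0 < f1 x] have an infinite likelihood ratio.  By the library's
   conventions [0 / 0 = 0]; this value is immaterial in [ghat0] and [ghat1] below,
   which vanish where [f0] and [f1] both do. *)
Definition lratio f0 f1 (x : T) : \bar R := ((f1 x)%:E / (f0 x)%:E)%E.

Definition clip (tl tu : R) (l : \bar R) : \bar R :=
  if (l < tl%:E)%E then tl%:E else if (l <= tu%:E)%E then l else tu%:E.

Section lfd_densities.
Variables (f0 f1 : T -> R) (eps0 tl tu : R).
Let l := lratio f0 f1.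

Definition beta : R :=
  eps0 / \int[mu]_(x in [set x | (l x < tl%:E)%E]) (tl * f0 x - f1 x).

Definition sigma : R :=
  eps0 / \int[mu]_(x in [set x | (tu%:E < l x)%E]) (f1 x - tu * f0 x).

Definition ghat0 (x : T) : R :=
  if (l x < tl%:E)%E then (1 - beta * tl) * f0 x + beta * f1 x
  else if (l x <= tu%:E)%E then f0 x
  else (1 - sigma * tu) * f0 x + sigma * f1 x.

Definition ghat1 (x : T) : R :=
  if (l x < tl%:E)%E then tl * ghat0 x
  else if (l x <= tu%:E)%E then f1 x
  else tu * ghat0 x.

End lfd_densities.

End robust_testing.

(* Main.v *)
(** Writing [lam] for the clipped likelihood ratio, the tangent-plane form of the
    weighted AM-GM inequality reads
      [b `^ u * a `^ (1 - u) <= (1 - u) * lam `^ u * a + u * lam `^ (u - 1) * b],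
    with equality iff [b = lam * a].  Integrated, it bounds [D_ u] on the
    neighborhoods by two linear functionals with bounded weights, and a linear
    functional of weight [w] grows by at most [eps] times the oscillation of [w]
    on a total variation ball of radius [eps].  The pair [ghat0], [ghat1] attains
    both bounds for every [u] simultaneously, since it moves exactly the allowed
    mass from one extreme level set of [lam] to the other: this is what the two
    equations
      [\int max (tl f0 - f1) 0 = eps1 + tl eps0],
      [\int max (f1 - tu f0) 0 = eps1 + tu eps0]
    say, and they have solutions [tl < 1 < tu] because the neighborhoods are
    disjoint.  The equality case of AM-GM gives [g1 = lam * g0] almost everywhere
    for every maximizing pair.  Finally [u |-> \int lam `^ u ghat0] is continuous,
    is at most 1 and equals 1 at both 0 and 1, so that a minimizing [u] exists in
    the open interval. *)

From HB Require Import structures.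
Require Import Defs.
From mathcomp Require Import all_boot all_order all_algebra.
From mathcomp Require Import ring lra.
From mathcomp Require Import all_classical all_reals all_analysis measurable_realfun.
Import Order.TTheory GRing.Theory Num.Theory.
Import numFieldNormedType.Exports.
Local Open Scope classical_set_scope.
Local Open Scope ring_scope.

Set Implicit Arguments.
Unset Strict Implicit.

(** * Weighted AM-GM in tangent form, and powers as functions of the exponent *)

Section weighted_means.
Context {R : realType}.
Implicit Types a b l x y u v : R.

Lemma powR_expR a u : 0 < a -> a `^ u = expR (u * ln a).
Proof. by move=> a0; rewrite /powR gt_eqF. Qed.

(** Dividing by the weighted geometric mean reduces the claim to [1 + z <= expR z] at two points
    whose weighted mean is 0; strictness comes from [1 + z < expR z] for [z != 0]. *)
Lemma lt_powR_mean x y u : 0 < u < 1 -> 0 <= x -> 0 <= y -> x != y ->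
  y `^ u * x `^ (1 - u) < (1 - u) * x + u * y.
Proof.
move=> /andP[u0 u1] x0 y0 xy.
have u1' : 0 < 1 - u by rewrite subr_gt0.
have [x_eq0|xn0] := eqVneq x 0.
  rewrite x_eq0 eq_sym in xy; rewrite x_eq0 powR0 ?gt_eqF//.
  by rewrite !mulr0 add0r mulr_gt0// lt_def xy.
have [->|yn0] := eqVneq y 0.
  by rewrite powR0 ?gt_eqF// mul0r mulr0 addr0 mulr_gt0// lt_def x0 xn0.
have {}x0 : 0 < x by rewrite lt_def x0 xn0.
have {}y0 : 0 < y by rewrite lt_def y0 yn0.
rewrite !powR_expR// -expRD.
(* [m] is the logarithm of the weighted geometric mean; [x] and [y] are then written relative to
   [expR m]. *)
set m := u * ln y + (1 - u) * ln x.
have ex : x = expR m * expR (ln x - m) by rewrite -expRD addrC subrK lnK.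
have ey : y = expR m * expR (ln y - m) by rewrite -expRD addrC subrK lnK.
have xm : ln x - m != 0.
  have -> : ln x - m = u * (ln x - ln y) by rewrite /m; ring.
  apply: mulf_neq0; first by rewrite gt_eqF.
  by rewrite subr_eq0; apply: contra xy => /eqP/ln_inj ->.
have := expR_gt1Dx xm; have := expR_ge1Dx (ln y - m).
have := expR_gt0 m; rewrite [X in _ < _ * X + _]ex [X in _ < _ + _ * X]ey.
move: (expR m) (expR (ln y - m)) (expR (ln x - m)) => E A B E0 Age Bgt.
have -> : (1 - u) * (E * B) + u * (E * A) = E * ((1 - u) * B + u * A) by ring.
rewrite -[X in X < _]mulr1 ltr_pM2l//.
(* The deviations of [ln x] and [ln y] from [m] average to 0, so the linear lower bounds average to
   1. *)
have e1 : (1 - u) * (1 + (ln x - m)) + u * (1 + (ln y - m)) = 1.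
  by rewrite /m; ring.
rewrite -[X in X < _]e1.
by apply: ltr_leD; [rewrite ltr_pM2l|rewrite ler_pM2l].
Qed.

(** This is AM-GM for [l]^ u * a[and]l [^ (u - 1) * b]: in their geometric mean the powers of [l]
    cancel, and the two are equal exactly when [b = l * a]. *)
Lemma powR_tangent l u a b : 0 < l -> 0 < u < 1 -> 0 <= a -> 0 <= b ->
  b `^ u * a `^ (1 - u) <= (1 - u) * (l `^ u * a) + u * (l `^ (u - 1) * b)
    ?= iff (b == l * a).
Proof.
move=> l0 u01 a0 b0; have /andP[u0 u1] := u01.
have ll : l `^ (u - 1) * l = l `^ u.
  by rewrite mulrC mulr_powRB1// ltW.
have eqE : (l `^ u * a == l `^ (u - 1) * b) = (b == l * a).
  have lu0 : l `^ (u - 1) != 0 by rewrite gt_eqF// powR_gt0.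
  by rewrite -ll -mulrA (inj_eq (mulfI lu0)) eq_sym.
have -> : b `^ u * a `^ (1 - u) =
    (l `^ (u - 1) * b) `^ u * (l `^ u * a) `^ (1 - u).
  rewrite !powRM ?powR_ge0// -!powRrM mulrACA -powRD ?(gt_eqF l0) ?implybT//.
  have -> : (u - 1) * u + u * (1 - u) = 0 by ring.
  by rewrite powRr0 mul1r.
have x0 : 0 <= l `^ u * a by rewrite mulr_ge0// powR_ge0.
have y0 : 0 <= l `^ (u - 1) * b by rewrite mulr_ge0// powR_ge0.
rewrite -eqE; move: (_ * a) (_ * b) x0 y0 => x y x0 y0.
have [->|xy] := eqVneq x y.
  by apply/leifP; rewrite -powRD ?subrKC ?oner_eq0// powRr1//; apply/eqP; ring.
by apply/leifP/lt_powR_mean.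
Qed.

Lemma lerB_powR c M l u v : 0 < c <= l -> l <= M -> c <= 1 -> 1 <= M ->
  0 <= u <= 1 -> 0 <= v <= 1 ->
  `|l `^ u - l `^ v| <= M * (ln M - ln c) * `|u - v|.
Proof.
move=> /andP[c0 cl] lM c1 M1; wlog: u v / l `^ v <= l `^ u => [hw|vu u01 v01].
  have [vu|uv] := leP (l `^ v) (l `^ u); first exact: hw.
  by move=> u01 v01; rewrite distrC (distrC u); apply: hw => //; exact: ltW.
have l0 : 0 < l by exact: lt_le_trans cl.
have M0 : 0 < M by exact: lt_le_trans M1.
have lnc : ln c <= ln l by rewrite ler_ln ?posrE.
have lnM : ln l <= ln M by rewrite ler_ln ?posrE.
have lnc0 : ln c <= 0 by rewrite ln_le0.
have lnM0 : 0 <= ln M by rewrite ln_ge0.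
rewrite ger0_norm ?subr_ge0//.
have luM : l `^ u <= M.
  have /andP[u0 u1] := u01; rewrite powR_expR// -[leRHS]lnK// ler_expR.
  have [ll0|/ltW ll0] := leP 0 (ln l).
    by rewrite (le_trans _ lnM)// ler_piMl.
  by rewrite (le_trans _ lnM0)// mulr_ge0_le0.
have -> : l `^ v = l `^ u * expR ((v - u) * ln l).
  by rewrite !powR_expR// -expRD; congr expR; ring.
have -> : l `^ u - l `^ u * expR ((v - u) * ln l) =
  l `^ u * (1 - expR ((v - u) * ln l)) by ring.
apply: (@le_trans _ _ (l `^ u * ((u - v) * ln l))).
  rewrite ler_pM2l ?powR_gt0//.
  by have := expR_ge1Dx ((v - u) * ln l); lra.
apply: (@le_trans _ _ (l `^ u * (`|u - v| * (ln M - ln c)))).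
  rewrite ler_pM2l ?powR_gt0// (le_trans (ler_norm _))// normrM.
  rewrite ler_wpM2l// ler_norml; apply/andP; split; lra.
rewrite (mulrC `|_|) -mulrA ler_wpM2r// mulr_ge0//; lra.
Qed.

End weighted_means.

(** * Integrability, densities, and the divergences computed from arbitrary densities *)

Section densities.
Context {d : measure_display} {T : measurableType d} {R : realType}.
Variable mu : {measure set T -> \bar R}.
Implicit Types (P F G : probability T R) (f g w : T -> R).

Lemma integrable_EFinD f g : mu.-integrable setT (EFin \o f) ->
  mu.-integrable setT (EFin \o g) ->
  mu.-integrable setT (EFin \o (fun x => f x + g x)).
Proof. by move=> fi gi; exact: (integrableD _ fi gi). Qed.

Lemma integrable_EFinB f g : mu.-integrable setT (EFin \o f) ->
  mu.-integrable setT (EFin \o g) ->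
  mu.-integrable setT (EFin \o (fun x => f x - g x)).
Proof. by move=> fi gi; exact: (integrableB _ fi gi). Qed.

Lemma integrable_EFinZl c f : mu.-integrable setT (EFin \o f) ->
  mu.-integrable setT (EFin \o (fun x => c * f x)).
Proof. by move=> fi; exact: (integrableZl _ _ fi). Qed.

Lemma integrable_EFin_measurable f : mu.-integrable setT (EFin \o f) ->
  measurable_fun setT f.
Proof. by move=> /measurable_int/measurable_EFinP. Qed.

Lemma le_integrable_EFin f g : measurable_fun setT f ->
  (forall x, `|f x| <= g x) -> mu.-integrable setT (EFin \o g) ->
  mu.-integrable setT (EFin \o f).
Proof.
move=> mf fg; apply: le_integrable => //; first exact/measurable_EFinP.
by move=> x _; rewrite /= lee_fin (le_trans (fg x))// ler_norm.
Qed.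

Lemma integrable_EFinMl f g M : measurable_fun setT f ->
  (forall x, `|f x| <= M) -> mu.-integrable setT (EFin \o g) ->
  mu.-integrable setT (EFin \o (fun x => f x * g x)).
Proof.
move=> mf fM gi; apply: (@le_integrable_EFin _ (fun x => M * `|g x|)).
- by apply: measurable_funM => //; exact: integrable_EFin_measurable.
- by move=> x; rewrite normrM ler_wpM2r.
- exact/integrable_EFinZl/integrable_norm.
Qed.

Lemma integrable_funmax0 f : mu.-integrable setT (EFin \o f) ->
  mu.-integrable setT (EFin \o (fun x => Num.max (f x) 0)).
Proof. by move=> fi; exact: (integrable_funrpos _ fi). Qed.

Lemma EFin_Rintegral f : mu.-integrable setT (EFin \o f) ->
  (\int[mu]_x (f x)%:E)%E = (\int[mu]_x f x)%:E.
Proof. by move=> fi; rewrite fineK//; exact: integrable_fin_num. Qed.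

Lemma ae_eq_Rintegral f g : measurable_fun setT f -> measurable_fun setT g ->
  {ae mu, forall x, f x = g x} -> \int[mu]_x f x = \int[mu]_x g x.
Proof.
move=> mf mg fg; congr fine; apply: ae_eq_integral => //;
  [exact/measurable_EFinP|exact/measurable_EFinP|].
by move: fg; apply: filterS => x -> .
Qed.

Lemma Rintegral_eq0_ae f : mu.-integrable setT (EFin \o f) ->
  (forall x, 0 <= f x) -> \int[mu]_x f x <= 0 -> {ae mu, forall x, f x = 0}.
Proof.
move=> fi f0 intf0.
have : ae_eq mu setT (EFin \o f) (cst 0%E).
  apply/ae_eq_integral_abs => //; first exact: measurable_int fi.
  under eq_integral do rewrite /= ger0_norm//.
  rewrite EFin_Rintegral//; congr EFin.
  by apply/eqP; rewrite eq_le intf0 Rintegral_ge0.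
by apply: filterS => x /= /(_ I) [].
Qed.

Lemma is_density_ge0 P f x : is_density mu P f -> 0 <= f x.
Proof. by case. Qed.

Lemma is_density_integrable P f : is_density mu P f ->
  mu.-integrable setT (EFin \o f).
Proof.
move=> [mf f0 Pf]; apply/integrableP; split; first exact/measurable_EFinP.
under eq_integral do rewrite /= ger0_norm//.
by rewrite -Pf// probability_setT ltry.
Qed.

Lemma is_density_Rintegral P f : is_density mu P f -> \int[mu]_x f x = 1.
Proof. by move=> [_ _ Pf]; rewrite /Rintegral -Pf// probability_setT. Qed.

Lemma is_density_ae_eq P f g : is_density mu P f -> is_density mu P g ->
  {ae mu, forall x, f x = g x}.
Proof.
move=> Pf Pg; have fi := is_density_integrable Pf.
have [mg _ Pg'] := Pg; have [_ _ Pf'] := Pf.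
have : ae_eq mu setT (EFin \o f) (EFin \o g).
  apply: integral_ae_eq => //; first exact/measurable_EFinP.
  by move=> E _ mE; rewrite -Pf'// -Pg'.
by apply: filterS => x /= /(_ I) [].
Qed.

Lemma density_is_density P f : is_density mu P f ->
  is_density mu P (density mu P).
Proof. by move=> Pf; apply: (@xgetPex _ _ [set f | is_density mu P f]); exists f. Qed.

Lemma exists_density_prob f : mu.-integrable setT (EFin \o f) ->
  (forall x, 0 <= f x) -> \int[mu]_x f x = 1 ->
  exists P : probability T R, is_density mu P f.
Proof.
move=> fi f0 f1; have mf := integrable_EFin_measurable fi.
pose m A := (\int[mu]_(x in A) (f x)%:E)%E.
have m0 : m set0 = 0%E by rewrite /m integral_set0.
have m_ge0 A : (0 <= m A)%E by apply: integral_ge0 => x _; rewrite lee_fin.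
have mS : semi_sigma_additive m.
  by apply: semi_sigma_additive_nng_induced => //; exact/measurable_EFinP.
have m1 : m setT = 1%E by rewrite /m EFin_Rintegral// f1.
pose mm := isMeasure.Build _ _ _ m m0 m_ge0 mS.
pose M : {measure set T -> \bar R} := HB.pack m mm.
pose mp := Measure_isProbability.Build _ _ _ M m1.
pose P : probability T R := HB.pack m mm mp.
by exists P; split.
Qed.

(** [D_TV] is defined through the chosen representative [density]; two densities of one measure
    agree almost everywhere, so any others may replace it. *)
Lemma D_TV_Rintegral G F g f : is_density mu G g -> is_density mu F f ->
  D_TV mu G F = (2^-1 * \int[mu]_x `|g x - f x|)%:E.
Proof.
move=> Gg Ff; have gi := is_density_integrable Gg.
have fi := is_density_integrable Ff.
have Gg' := density_is_density Gg; have Ff' := density_is_density Ff.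
have gi' := is_density_integrable Gg'; have fi' := is_density_integrable Ff'.
rewrite /D_TV (_ : \int[mu]_x `|g x - f x| =
    \int[mu]_x `|density mu G x - density mu F x|).
  rewrite EFin_Rintegral//; exact/integrable_norm/integrable_EFinB.
apply: ae_eq_Rintegral.
- apply: measurableT_comp => //.
  exact/(integrable_EFin_measurable (integrable_EFinB gi fi)).
- apply: measurableT_comp => //.
  exact/(integrable_EFin_measurable (integrable_EFinB gi' fi')).
- have := is_density_ae_eq Gg Gg'; have := is_density_ae_eq Ff Ff'.
  by apply: filterS2 => x -> ->.
Qed.

Lemma tv_nbhdP G F g f (e : R) : is_density mu G g -> is_density mu F f ->
  tv_nbhd mu F e G <-> \int[mu]_x `|g x - f x| <= 2 * e.
Proof.
move=> Gg Ff; rewrite /tv_nbhd/= (D_TV_Rintegral Gg Ff) lee_fin.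
by rewrite ler_pdivrMl//; split => [[]//|]; split => //; exists g.
Qed.

(** The weighted geometric mean is dominated by the arithmetic one, which is [powR_tangent] with
    [l = 1]. *)
Lemma integrable_powR_mean (u : R) f g : 0 < u < 1 ->
  (forall x, 0 <= f x) -> (forall x, 0 <= g x) ->
  mu.-integrable setT (EFin \o f) -> mu.-integrable setT (EFin \o g) ->
  mu.-integrable setT (EFin \o (fun x => g x `^ u * f x `^ (1 - u))).
Proof.
move=> u01 f0 g0 fi gi.
have := integrable_EFinD (integrable_EFinZl (1 - u) fi) (integrable_EFinZl u gi).
apply: le_integrable_EFin.
  by apply: measurable_funM; apply: (measurableT_comp (@measurable_powR R _));
    exact: integrable_EFin_measurable.
move=> x; rewrite ger0_norm ?mulr_ge0 ?powR_ge0//.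
by have [] := powR_tangent (@ltr01 R) u01 (f0 x) (g0 x); rewrite !powR1 !mul1r.
Qed.

Lemma D_Rintegral (u : R) G0 G1 g0 g1 : 0 < u < 1 ->
  is_density mu G0 g0 -> is_density mu G1 g1 ->
  D_ mu u G0 G1 = (\int[mu]_x (g1 x `^ u * g0 x `^ (1 - u)))%:E.
Proof.
move=> u01 Gg0 Gg1.
have Gg0' := density_is_density Gg0; have Gg1' := density_is_density Gg1.
have int P Q f g : is_density mu P f -> is_density mu Q g ->
    mu.-integrable setT (EFin \o (fun x => g x `^ u * f x `^ (1 - u))).
  move=> Pf Qg; apply: integrable_powR_mean => //.
  - by move=> x; exact: is_density_ge0 Pf.
  - by move=> x; exact: is_density_ge0 Qg.
  - exact: is_density_integrable Pf.
  - exact: is_density_integrable Qg.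
have i := int _ _ _ _ Gg0 Gg1; have i' := int _ _ _ _ Gg0' Gg1'.
rewrite /D_ (EFin_Rintegral i'); congr EFin.
apply: ae_eq_Rintegral; [exact: integrable_EFin_measurable i'|
  exact: integrable_EFin_measurable i|].
have := is_density_ae_eq Gg0 Gg0'; have := is_density_ae_eq Gg1 Gg1'.
by apply: filterS2 => x -> ->.
Qed.

(* Centring the weight at [(a + b) / 2] halves its sup norm; this is allowed
   because [g - f] has total mass 0. *)
Lemma tv_nbhd_weighted_le G F g f (e : R) w a b :
  is_density mu G g -> is_density mu F f -> tv_nbhd mu F e G ->
  measurable_fun setT w -> (forall x, a <= w x <= b) ->
  \int[mu]_x (w x * g x) <= \int[mu]_x (w x * f x) + (b - a) * e.
Proof.
move=> Gg Ff /(tv_nbhdP _ Gg Ff) tve mw wab.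
have gi := is_density_integrable Gg; have fi := is_density_integrable Ff.
have gfi := integrable_EFinB gi fi.
have wM x : `|w x| <= `|a| + `|b|.
  have := ler_norm b; have := ler_norm (- a); rewrite normrN ler_norml.
  by have := wab x; have := normr_ge0 a; have := normr_ge0 b; lra.
have wi := integrable_EFinMl mw wM.
rewrite -lerBlDl -RintegralB//; [|exact: wi|exact: wi].
set c := (a + b) / 2.
have -> : \int[mu]_x (w x * g x - w x * f x) =
    \int[mu]_x ((w x * g x - w x * f x) - c * (g x - f x)).
  rewrite [RHS]RintegralB//; [|exact/integrable_EFinB/wi/fi/wi/gi|
    exact: integrable_EFinZl].
  rewrite RintegralZl// [in X in c * X]RintegralB//.
  by rewrite (is_density_Rintegral Gg) (is_density_Rintegral Ff) subrr mulr0 subr0.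
apply: (@le_trans _ _ (\int[mu]_x ((b - a) / 2 * `|g x - f x|))).
  apply: le_Rintegral => //.
  - by apply/integrable_EFinB/integrable_EFinZl => //; exact/integrable_EFinB/wi/fi/wi/gi.
  - exact/integrable_EFinZl/integrable_norm.
  move=> x _.
  have -> : w x * g x - w x * f x - c * (g x - f x) = (w x - c) * (g x - f x).
    by ring.
  rewrite (le_trans (ler_norm _))// normrM ler_wpM2r// /c ler_norml.
  by have := wab x; lra.
rewrite RintegralZl//; last exact: integrable_norm.
have /andP[aw wb] := wab point.
rewrite -mulrA ler_wpM2l ?subr_ge0 ?(le_trans aw)//.
by rewrite ler_pdivrMl.
Qed.

End densities.

(** * Intermediate values of Lipschitz functions *)

Section lipschitz.
Context {R : realType}.

Lemma lipschitz_within_continuous (f : R -> R) (A : set R) (K : R) :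
  (forall x y, A x -> A y -> `|f x - f y| <= K * `|x - y|) ->
  {within A, continuous f}.
Proof.
move=> fK; apply/subspace_continuousP => x Ax.
have K0 : 0 < `|K| + 1 by rewrite ltr_wpDl.
apply/cvgrPdist_lt => e e0; rewrite near_withinE; near=> y => Ay.
rewrite (le_lt_trans (fK _ _ Ax Ay))//.
apply: (@le_lt_trans _ _ ((`|K| + 1) * `|x - y|)).
  by rewrite ler_wpM2r// (le_trans (ler_norm K))// lerDl.
rewrite mulrC -ltr_pdivlMr//; near: y.
by apply: cvgr_dist_lt; rewrite ?divr_gt0//; exact: cvg_id.
Unshelve. all: by end_near. Qed.

(** A zero at an end point would make the product vanish, so the zero lies strictly inside; this
    yields the strict inequalities between the thresholds and 1. *)
Lemma lipschitz_IVT (f : R -> R) (a b K : R) : a <= b ->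
  (forall x y, `|f x - f y| <= K * `|x - y|) ->
  f a * f b < 0 -> exists2 c, a < c < b & f c = 0.
Proof.
move=> ab fK fab.
have cf : {within `[a, b], continuous f}.
  by apply: lipschitz_within_continuous => x y _ _; exact: fK.
have [|c /[!in_itv]/= /andP[ac cb] fc] := IVT (v := 0) ab cf.
  by rewrite ge_min le_max; have [|] := leP (f a) 0; have [|] := leP (f b) 0;
    rewrite ?orbT//=; nra.
exists c => //; rewrite !lt_neqAle ac cb !andbT.
apply/andP; split; apply: contraTneq fab.
  by move=> ->; rewrite fc mul0r ltxx.
by move=> <-; rewrite fc mulr0 ltxx.
Qed.

End lipschitz.

(** * Pointwise analysis of the clipped likelihood ratio *)

Section clipping.
Context {d : measure_display} {T : measurableType d} {R : realType}.
Variables (f0 f1 : T -> R) (tl tu : R).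
Hypotheses (tl0 : 0 < tl) (tltu : tl < tu).

(** For nonnegative densities and [0 < tl < tu] the clipped ratio is finite, so [fine] loses
    nothing; see [fine_clip_lratio]. *)
Definition clipped (x : T) : R := fine (clip tl tu (lratio f0 f1 x)).

(** The three regions are described by inequalities free of division. [ClipLow] is not strict
    because it also holds the points with [a = b = 0], where the ratio is 0 by convention; an
    infinite ratio falls under [ClipHigh]. *)
Variant clip_spec (a b : R) : bool -> bool -> R -> Type :=
| ClipLow of b <= tl * a : clip_spec a b true true tl
| ClipMid of 0 < a & tl * a <= b & b <= tu * a : clip_spec a b false true (b / a)
| ClipHigh of tu * a < b : clip_spec a b false false tu.

Variable x : T.
Hypotheses (f0_ge0 : 0 <= f0 x) (f1_ge0 : 0 <= f1 x).

Lemma lratio0 : f0 x = 0 ->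
  lratio f0 f1 x = if f1 x == 0 then 0%E else +oo%E.
Proof.
rewrite /lratio => ->; rewrite inve0; have [->|f1n0] := eqVneq; first by rewrite mul0e.
by rewrite gt0_muley// lte_fin lt_def f1n0.
Qed.

Lemma lratio_gt0 : 0 < f0 x -> lratio f0 f1 x = (f1 x / f0 x)%:E.
Proof. by move=> f0x; rewrite /lratio inver gt_eqF. Qed.

Lemma clip_lratioP : clip_spec (f0 x) (f1 x) (lratio f0 f1 x < tl%:E)%E
  (lratio f0 f1 x <= tu%:E)%E (clipped x).
Proof.
have tu0 : 0 < tu := lt_trans tl0 tltu.
rewrite /clipped /clip.
have [f0x|f0x|f0x] := ltgtP (f0 x) 0; first by rewrite ltNge f0_ge0 in f0x.
  rewrite lratio_gt0// lte_fin lee_fin ltr_pdivrMr// ler_pdivrMr//.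
  have [lt|le] := ltP (f1 x) (tl * f0 x).
    suff -> : f1 x <= tu * f0 x by constructor; exact: ltW.
    by rewrite (le_trans (ltW lt))// ler_wpM2r// ltW.
  by have [le'|lt] := leP (f1 x) (tu * f0 x); constructor.
rewrite lratio0//; have [f1x|f1x] := eqVneq (f1 x) 0.
  by rewrite lte_fin lee_fin tl0 ltW//=; constructor; rewrite f0x f1x mulr0.
by constructor; rewrite f0x mulr0 lt_def f1x.
Qed.

Lemma fine_clip_lratio : clip tl tu (lratio f0 f1 x) = (clipped x)%:E.
Proof.
rewrite /clipped fineK// /clip; case: clip_lratioP => //.
by move=> f0x _ _; rewrite lratio_gt0.
Qed.

Lemma clipped_itv : tl <= clipped x <= tu.
Proof.
case: clip_lratioP => [_|f0x le1 le2|_]; rewrite ?lexx ?(ltW tltu)//.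
by rewrite ler_pdivlMr// le1 ler_pdivrMr.
Qed.

(** The positive part vanishes unless the ratio is clipped to [tl], so on its support any weight
    depending on the clipped ratio is constant. *)
Lemma clipped_low (w : R -> R) : w (clipped x) * Num.max (tl * f0 x - f1 x) 0 =
  w tl * Num.max (tl * f0 x - f1 x) 0.
Proof.
case: clip_lratioP => // [_ le _|lt]; first by rewrite max_r ?mulr0// subr_le0.
rewrite max_r ?mulr0// subr_le0 (le_trans _ (ltW lt))//.
by rewrite ler_wpM2r// ltW.
Qed.

Lemma clipped_high (w : R -> R) : w (clipped x) * Num.max (f1 x - tu * f0 x) 0 =
  w tu * Num.max (f1 x - tu * f0 x) 0.
Proof.
case: clip_lratioP => // [le|_ _ le]; last by rewrite max_r ?mulr0// subr_le0.
rewrite max_r ?mulr0// subr_le0 (le_trans le)//.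
by rewrite ler_wpM2r// ltW.
Qed.

End clipping.

(** * Existence of the thresholds for disjoint neighborhoods *)

Section thresholds.
Context {d : measure_display} {T : measurableType d} {R : realType}.
Variable mu : {measure set T -> \bar R}.
Implicit Types (f g k : T -> R).

Lemma le_dist_Rintegral f g k : mu.-integrable setT (EFin \o f) ->
  mu.-integrable setT (EFin \o g) -> mu.-integrable setT (EFin \o k) ->
  (forall x, `|f x - g x| <= k x) ->
  `|\int[mu]_x f x - \int[mu]_x g x| <= \int[mu]_x k x.
Proof.
move=> fi gi ki fgk; rewrite -RintegralB//.
have fgi := integrable_EFinB fi gi.
rewrite (le_trans (le_normr_Rintegral _ fgi))//.
by apply: le_Rintegral => //; exact: integrable_norm fgi.
Qed.

Lemma dist_max0 (a b : R) : `|Num.max a 0 - Num.max b 0| <= `|a - b|.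
Proof.
rewrite ler_norml; have := ler_norm (a - b); have := ler_norm (b - a).
rewrite (distrC b a); have := normr_ge0 (a - b).
by have [a0|a0] := leP a 0; have [b0|b0] := leP b 0; lra.
Qed.

Variables (F0 F1 : probability T R) (f0 f1 : T -> R) (eps0 eps1 : R).
Hypotheses (Ff0 : is_density mu F0 f0) (Ff1 : is_density mu F1 f1).
Hypotheses (eps0_gt0 : 0 < eps0) (eps1_gt0 : 0 < eps1).

Let f0i := is_density_integrable Ff0.
Let f1i := is_density_integrable Ff1.
Let int_f0 := is_density_Rintegral Ff0.
Let int_f1 := is_density_Rintegral Ff1.

(* If the radii added up to the distance of the nominals, the segment from [F0]
   to [F1] would meet both neighborhoods at the parameter [eps0 / (eps0 + eps1)]. *)
Lemma disjoint_tv_nbhd_dist : tv_nbhd mu F0 eps0 `&` tv_nbhd mu F1 eps1 = set0 ->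
  2 * (eps0 + eps1) < \int[mu]_x `|f0 x - f1 x|.
Proof.
move=> dis; rewrite ltNge; apply/negP => le.
have e0 : 0 < eps0 + eps1 by rewrite addr_gt0.
pose s := eps0 / (eps0 + eps1).
have s0 : 0 <= s by rewrite divr_ge0 ?ltW.
have s1 : s <= 1 by rewrite ler_pdivrMr// mul1r lerDl ltW.
have s1' : 0 <= 1 - s by rewrite subr_ge0.
have [|||G Gg] := @exists_density_prob _ _ _ mu (fun x => (1 - s) * f0 x + s * f1 x).
- by apply/integrable_EFinD; exact: integrable_EFinZl.
- by move=> x; rewrite addr_ge0// mulr_ge0//; [case: Ff0|case: Ff1].
- rewrite RintegralD//; [|exact: integrable_EFinZl|exact: integrable_EFinZl].
  by rewrite !RintegralZl// int_f0 int_f1; ring.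
have ni : mu.-integrable setT (EFin \o (fun x => `|f0 x - f1 x|)).
  exact/integrable_norm/integrable_EFinB.
have : (tv_nbhd mu F0 eps0 `&` tv_nbhd mu F1 eps1) G.
  split; [apply/(tv_nbhdP _ Gg Ff0)|apply/(tv_nbhdP _ Gg Ff1)].
  - rewrite (_ : \int[mu]_x _ = \int[mu]_x (s * `|f0 x - f1 x|)).
      rewrite RintegralZl// (le_trans (ler_wpM2l s0 le))// le_eqVlt.
      by apply/orP; left; apply/eqP; rewrite /s; field; rewrite gt_eqF.
    apply: eq_Rintegral => x _; rewrite -[X in _ = X * _](ger0_norm s0) -normrM.
    by rewrite distrC; congr `|_|; ring.
  - rewrite (_ : \int[mu]_x _ = \int[mu]_x ((1 - s) * `|f0 x - f1 x|)).
      rewrite RintegralZl// (le_trans (ler_wpM2l s1' le))// le_eqVlt.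
      by apply/orP; left; apply/eqP; rewrite /s; field; rewrite gt_eqF.
    apply: eq_Rintegral => x _; rewrite -[X in _ = X * _](ger0_norm s1') -normrM.
    by congr `|_|; ring.
by rewrite dis.
Qed.

(** The absolute value of a number is twice its positive part minus the number, and here the
    difference integrates to 0. *)
Lemma Rintegral_pospart_half f g : mu.-integrable setT (EFin \o f) ->
  mu.-integrable setT (EFin \o g) -> \int[mu]_x f x = \int[mu]_x g x ->
  \int[mu]_x `|f x - g x| = 2 * \int[mu]_x Num.max (f x - g x) 0.
Proof.
move=> fi gi fg; have fgi := integrable_EFinB fi gi.
have mi := integrable_funmax0 fgi.
rewrite -RintegralZl//.
transitivity (\int[mu]_x (2 * Num.max (f x - g x) 0 - (f x - g x))).
  apply: eq_Rintegral => x _; have [fg0|fg0] := leP (f x - g x) 0.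
    by rewrite ler0_norm//; ring.
  by rewrite gtr0_norm//; ring.
rewrite RintegralB//; last exact: integrable_EFinZl.
by rewrite [X in _ - X]RintegralB// fg subrr subr0.
Qed.

Hypothesis far : 2 * (eps0 + eps1) < \int[mu]_x `|f0 x - f1 x|.

(** The defect [phi] of the equation is Lipschitz, equals [- eps1] at 0, and at 1 is half the
    distance of the nominals minus [eps0 + eps1], which [far] makes positive. *)
Lemma exists_lower_threshold : exists2 t : R, 0 < t < 1 &
  \int[mu]_x Num.max (t * f0 x - f1 x) 0 = eps1 + t * eps0.
Proof.
have fi t : mu.-integrable setT (EFin \o (fun x => t * f0 x - f1 x)).
  exact/integrable_EFinB/f1i/integrable_EFinZl.
have mi t := integrable_funmax0 (fi t).
pose phi t := \int[mu]_x Num.max (t * f0 x - f1 x) 0 - (eps1 + t * eps0).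
(* The positive part is 1-Lipschitz and [f0] has mass 1, which gives the constant 1; the term
   [t * eps0] adds [eps0]. *)
have phiK x y : `|phi x - phi y| <= (1 + eps0) * `|x - y|.
  have h : `|\int[mu]_z Num.max (x * f0 z - f1 z) 0 -
      \int[mu]_z Num.max (y * f0 z - f1 z) 0| <= `|x - y|.
    have -> : `|x - y| = \int[mu]_z (`|x - y| * f0 z).
      by rewrite RintegralZl// int_f0 mulr1.
    apply: le_dist_Rintegral => //; first exact: integrable_EFinZl.
    move=> z; rewrite (le_trans (dist_max0 _ _))//.
    rewrite -[X in _ <= _ * X]ger0_norm; last by case: Ff0.
    by rewrite -normrM le_eqVlt; apply/orP; left; apply/eqP; congr `|_|; ring.
  have -> : phi x - phi y = \int[mu]_z Num.max (x * f0 z - f1 z) 0 -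
      \int[mu]_z Num.max (y * f0 z - f1 z) 0 - eps0 * (x - y).
    by rewrite /phi; ring.
  rewrite (le_trans (ler_normB _ _))// mulrDl mul1r lerD//.
  by rewrite normrM gtr0_norm.
have phi0 : phi 0 < 0.
  rewrite /phi mul0r addr0 [X in X - _](_ : _ = \int[mu]_x (0 : R)).
    by rewrite Rintegral_cst// mul0r sub0r oppr_lt0.
  by apply: eq_Rintegral => x _; rewrite mul0r sub0r max_r// oppr_le0; case: Ff1.
have phi1 : 0 < phi 1.
  have := Rintegral_pospart_half f0i f1i; rewrite int_f0 int_f1 => /(_ erefl).
  rewrite /phi; under [in X in _ -> X]eq_Rintegral do rewrite mul1r.
  by move: far => /[swap] ->; lra.
have phi01 : phi 0 * phi 1 < 0 by rewrite nmulr_rlt0.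
have [c c01 phic] := lipschitz_IVT ler01 phiK phi01.
by exists c => //; apply/eqP; rewrite -subr_eq0; apply/eqP.
Qed.

Lemma exists_upper_threshold : exists2 t : R, 1 < t &
  \int[mu]_x Num.max (f1 x - t * f0 x) 0 = eps1 + t * eps0.
Proof.
have fi t : mu.-integrable setT (EFin \o (fun x => f1 x - t * f0 x)).
  exact/integrable_EFinB/integrable_EFinZl.
have mi t := integrable_funmax0 (fi t).
pose psi t := \int[mu]_x Num.max (f1 x - t * f0 x) 0 - (eps1 + t * eps0).
have psiK x y : `|psi x - psi y| <= (1 + eps0) * `|x - y|.
  have h : `|\int[mu]_z Num.max (f1 z - x * f0 z) 0 -
      \int[mu]_z Num.max (f1 z - y * f0 z) 0| <= `|x - y|.
    have -> : `|x - y| = \int[mu]_z (`|x - y| * f0 z).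
      by rewrite RintegralZl// int_f0 mulr1.
    apply: le_dist_Rintegral => //; first exact: integrable_EFinZl.
    move=> z; rewrite (le_trans (dist_max0 _ _))//.
    rewrite -[X in _ <= _ * X]ger0_norm; last by case: Ff0.
    rewrite -normrM distrC le_eqVlt; apply/orP; left; apply/eqP.
    by congr `|_|; ring.
  have -> : psi x - psi y = \int[mu]_z Num.max (f1 z - x * f0 z) 0 -
      \int[mu]_z Num.max (f1 z - y * f0 z) 0 - eps0 * (x - y).
    by rewrite /psi; ring.
  rewrite (le_trans (ler_normB _ _))// mulrDl mul1r lerD//.
  by rewrite normrM gtr0_norm.
have psi1 : 0 < psi 1.
  have := Rintegral_pospart_half f1i f0i; rewrite int_f0 int_f1 => /(_ erefl).
  rewrite /psi; under [in X in _ -> X]eq_Rintegral do rewrite mul1r.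
  under eq_Rintegral do rewrite distrC.
  by move: far => /[swap] ->; lra.
have e0 : eps0^-1 * eps0 = 1 by rewrite mulVf// gt_eqF.
(* At [t = 1 + eps0^-1] the right-hand side is [eps1 + eps0 + 1], above the mass 1 of [f1] that
   bounds the integral. *)
have b1 : 1 <= 1 + eps0^-1 by rewrite lerDl invr_ge0 ltW.
have psib : psi (1 + eps0^-1) < 0.
  have : \int[mu]_x Num.max (f1 x - (1 + eps0^-1) * f0 x) 0 <= 1.
    rewrite -[leRHS]int_f1; apply: le_Rintegral => // x _.
    have x0 : 0 <= f0 x by case: Ff0.
    rewrite ge_max lerBlDr lerDl mulr_ge0 ?(le_trans ler01 b1)//=.
    by case: Ff1.
  rewrite /psi mulrDl mul1r e0; move: eps0_gt0 eps1_gt0; lra.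
have psi1b : psi 1 * psi (1 + eps0^-1) < 0 by rewrite pmulr_rlt0.
have [c /andP[c1 _] psic] := lipschitz_IVT b1 psiK psi1b.
by exists c => //; apply/eqP; rewrite -subr_eq0; apply/eqP.
Qed.

End thresholds.

(** * The pair [ghat0], [ghat1] for thresholds that solve the two equations *)

Section least_favorable_pair.
Context {d : measure_display} {T : measurableType d} {R : realType}.
Variable mu : {measure set T -> \bar R}.
Variables (F0 F1 : probability T R) (f0 f1 : T -> R) (eps0 eps1 tl tu : R).
Hypotheses (Ff0 : is_density mu F0 f0) (Ff1 : is_density mu F1 f1).
Hypotheses (eps0_gt0 : 0 < eps0) (eps1_gt0 : 0 < eps1).
Hypotheses (tl_gt0 : 0 < tl) (tl_lt1 : tl < 1) (tu_gt1 : 1 < tu).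
Hypothesis int_low :
  \int[mu]_x Num.max (tl * f0 x - f1 x) 0 = eps1 + tl * eps0.
Hypothesis int_high :
  \int[mu]_x Num.max (f1 x - tu * f0 x) 0 = eps1 + tu * eps0.

Let f0_ge0 x : 0 <= f0 x. Proof. by case: Ff0. Qed.
Let f1_ge0 x : 0 <= f1 x. Proof. by case: Ff1. Qed.
Let f0i := is_density_integrable Ff0.
Let f1i := is_density_integrable Ff1.
Let mf0 := integrable_EFin_measurable f0i.
Let mf1 := integrable_EFin_measurable f1i.
Let tltu : tl < tu := lt_trans tl_lt1 tu_gt1.
Let tu_gt0 : 0 < tu := lt_trans tl_gt0 tltu.

Local Notation low x := (Num.max (tl * f0 x - f1 x) 0).
Local Notation high x := (Num.max (f1 x - tu * f0 x) 0).
Local Notation lam := (clipped f0 f1 tl tu).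
Local Notation bet := (beta mu f0 f1 eps0 tl).
Local Notation sig := (sigma mu f0 f1 eps0 tu).
Local Notation gh0 := (ghat0 mu f0 f1 eps0 tl tu).
Local Notation gh1 := (ghat1 mu f0 f1 eps0 tl tu).

Let lowi : mu.-integrable setT (EFin \o (fun x => low x)).
Proof. exact/integrable_funmax0/integrable_EFinB/f1i/integrable_EFinZl. Qed.

Let highi : mu.-integrable setT (EFin \o (fun x => high x)).
Proof. exact/integrable_funmax0/integrable_EFinB/integrable_EFinZl. Qed.

Let lamP x := clip_lratioP tl_gt0 tltu (f0_ge0 x) (f1_ge0 x).
Let lam_itv x := clipped_itv tl_gt0 tltu (f0_ge0 x) (f1_ge0 x).
Let lam_gt0 x : 0 < lam x.
Proof. by have /andP[+ _] := lam_itv x; exact: lt_le_trans. Qed.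

(** Where the ratio is below [tl] the integrand of [beta] is its own positive part, which vanishes
    elsewhere; [int_low] then evaluates the denominator. *)
Lemma betaE : bet = eps0 / (eps1 + tl * eps0).
Proof.
rewrite /beta -int_low Rintegral_mkcond; congr (_ / _).
apply: eq_Rintegral => x _; rewrite patchE.
have -> : (x \in [set x | (lratio f0 f1 x < tl%:E)%E]) =
    (lratio f0 f1 x < tl%:E)%E by apply/idP/idP; rewrite inE.
case: lamP => [le|_ le _|lt]; first by rewrite max_l// subr_ge0.
  by rewrite max_r// subr_le0.
by rewrite max_r// subr_le0 (le_trans _ (ltW lt))// ler_wpM2r// ltW.
Qed.

Lemma sigmaE : sig = eps0 / (eps1 + tu * eps0).
Proof.
rewrite /sigma -int_high Rintegral_mkcond; congr (_ / _).
apply: eq_Rintegral => x _; rewrite patchE.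
have -> : (x \in [set x | (tu%:E < lratio f0 f1 x)%E]) =
    ~~ (lratio f0 f1 x <= tu%:E)%E by rewrite -ltNge; apply/idP/idP; rewrite inE.
case: lamP => [le|_ _ le|lt]; last by rewrite max_l// subr_ge0 ltW.
  by rewrite max_r// subr_le0 (le_trans le)// ler_wpM2r// ltW.
by rewrite max_r// subr_le0.
Qed.

Let low_gt0 : 0 < eps1 + tl * eps0. Proof. by rewrite addr_gt0// mulr_gt0. Qed.
Let high_gt0 : 0 < eps1 + tu * eps0. Proof. by rewrite addr_gt0// mulr_gt0. Qed.

Let beta_ge0 : 0 <= bet. Proof. by rewrite betaE divr_ge0// ltW. Qed.
Let sigma_ge0 : 0 <= sig. Proof. by rewrite sigmaE divr_ge0// ltW. Qed.

(** The closed form gives [bet * tl = tl * eps0 / (eps1 + tl * eps0)]. This makes the coefficient of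
    [f0] in the lower branch of [ghat0] nonnegative. *)
Let beta_le1 : 0 <= 1 - bet * tl.
Proof.
by rewrite betaE mulrAC subr_ge0 ler_pdivrMr// mul1r mulrC lerDr ltW.
Qed.

Let sigma_le1 : 0 <= 1 - sig * tu.
Proof.
by rewrite sigmaE mulrAC subr_ge0 ler_pdivrMr// mul1r mulrC lerDr ltW.
Qed.

Lemma beta_low : bet * \int[mu]_x low x = eps0.
Proof. by rewrite betaE int_low divfK// gt_eqF. Qed.

Lemma sigma_high : sig * \int[mu]_x high x = eps0.
Proof. by rewrite sigmaE int_high divfK// gt_eqF. Qed.

Lemma ghat0_ge0 x : 0 <= gh0 x.
Proof. by rewrite /ghat0; case: lamP => // _; apply: addr_ge0; apply: mulr_ge0. Qed.

Lemma ghat1_clipped x : gh1 x = lam x * gh0 x.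
Proof.
rewrite /ghat1 /ghat0; case: lamP => // f0x _ _.
by rewrite divfK// gt_eqF.
Qed.

(** In this form without branches, [bet * low] is the mass removed where the ratio is small and
    [sig * high] the mass added where it is large; both total [eps0]. *)
Lemma ghat0E x : gh0 x = f0 x - bet * low x + sig * high x.
Proof.
rewrite /ghat0; case: lamP => [le|_ le1 le2|lt].
- rewrite max_l ?subr_ge0// max_r; first by ring.
  by rewrite subr_le0 (le_trans le)// ler_wpM2r// ltW.
- by rewrite !max_r ?subr_le0//; ring.
- rewrite max_r; last first.
    by rewrite subr_le0 (le_trans _ (ltW lt))// ler_wpM2r// ltW.
  by rewrite max_l ?subr_ge0 1?ltW//; ring.
Qed.

(** Here mass moves in the direction opposite to [ghat0E], and both amounts total [eps1]. *)
Lemma ghat1E x :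
  gh1 x = f1 x + (1 - bet * tl) * low x - (1 - sig * tu) * high x.
Proof.
rewrite /ghat1 /ghat0; case: lamP => [le|_ le1 le2|lt].
- rewrite max_l ?subr_ge0// max_r; first by ring.
  by rewrite subr_le0 (le_trans le)// ler_wpM2r// ltW.
- by rewrite !max_r ?subr_le0//; ring.
- rewrite max_r; last first.
    by rewrite subr_le0 (le_trans _ (ltW lt))// ler_wpM2r// ltW.
  by rewrite max_l ?subr_ge0 1?ltW//; ring.
Qed.

Lemma ghat1_ge0 x : 0 <= gh1 x.
Proof. by rewrite ghat1_clipped mulr_ge0 ?ghat0_ge0// ltW. Qed.

Lemma measurable_clipped : measurable_fun setT lam.
Proof.
(* A formula in real functions: the test for [f0 x] and [f1 x] both 0 encodes the convention
   [0 / 0 = 0], and the inverse is the power [-1], so that measurability of [powR] applies. *)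
pose l x := if (f1 x < tl * f0 x) || ((f0 x == 0) && (f1 x == 0)) then tl
  else if f1 x <= tu * f0 x then f1 x * f0 x `^ (-1) else tu.
have -> : lam = l.
  apply/funext => x; rewrite /l powR_inv1// /clipped /clip.
  have [f0x|f0x|f0x] := ltgtP (f0 x) 0; first by rewrite ltNge f0_ge0 in f0x.
    rewrite lratio_gt0// lte_fin lee_fin ltr_pdivrMr// ler_pdivrMr//= orbF.
    by case: ifP => // _; case: ifP.
  rewrite lratio0// f0x !mulr0 (ltNge (f1 x)) f1_ge0/=.
  have [f1x|f1x] := eqVneq (f1 x) 0; first by rewrite lte_fin tl_gt0.
  by rewrite (le_eqVlt (f1 x)) (negPf f1x) (ltNge (f1 x)) f1_ge0.
have mM c (f : T -> R) : measurable_fun setT f ->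
    measurable_fun setT (fun x => c * f x).
  by move=> mf; exact: measurable_funM.
apply: measurable_fun_ifT => //.
  apply: measurable_or; first exact: measurable_fun_ltr mf1 (mM tl f0 mf0).
  by apply: measurable_and; exact: measurable_fun_eqr.
apply: measurable_fun_ifT => //; first exact: measurable_fun_ler mf1 (mM tu f0 mf0).
apply: measurable_funM => //.
exact: (measurableT_comp (@measurable_powR R _)).
Qed.

Let ghat0i : mu.-integrable setT (EFin \o gh0).
Proof.
rewrite (_ : gh0 = fun x => f0 x - bet * low x + sig * high x); last first.
  by apply/funext => x; rewrite ghat0E.
by apply/integrable_EFinD/integrable_EFinZl => //;
  apply/integrable_EFinB/integrable_EFinZl.
Qed.

Let ghat1i : mu.-integrable setT (EFin \o gh1).
Proof.
rewrite (_ : gh1 = fun x => f1 x + (1 - bet * tl) * low x -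
  (1 - sig * tu) * high x); last by apply/funext => x; rewrite ghat1E.
by apply/integrable_EFinB/integrable_EFinZl => //;
  apply/integrable_EFinD/integrable_EFinZl.
Qed.

(** * Linear functionals of the pair with weights that depend on [lam] only *)

Section weighted.
Variables (w : R -> R) (M : R).
Hypotheses (mw : measurable_fun setT (fun x => w (lam x)))
  (wM : forall x, `|w (lam x)| <= M).

Let wi g : mu.-integrable setT (EFin \o g) ->
  mu.-integrable setT (EFin \o (fun x => w (lam x) * g x)).
Proof. exact: integrable_EFinMl wM. Qed.

(** Mass [eps0] leaves the set where the weight is [w tl] and reaches the set where it is [w tu].
    For increasing [w] this attains the bound of [tv_nbhd_weighted_le]; constant [w] gives total
    mass 1. *)
Lemma Rintegral_weighted_ghat0 :
  \int[mu]_x (w (lam x) * gh0 x) =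
  \int[mu]_x (w (lam x) * f0 x) + (w tu - w tl) * eps0.
Proof.
transitivity (\int[mu]_x (w (lam x) * f0 x - (w tl * bet) * low x +
    (w tu * sig) * high x)).
  apply: eq_Rintegral => x _; rewrite ghat0E.
  have := clipped_low tl_gt0 tltu (f0_ge0 x) (f1_ge0 x) w.
  have := clipped_high tl_gt0 tltu (f0_ge0 x) (f1_ge0 x) w.
  by move=> eh el; rewrite mulrDr mulrBr !(mulrCA _ bet) !(mulrCA _ sig) eh el; ring.
have i1 := wi f0i; have i2 := integrable_EFinZl (w tl * bet) lowi.
have i3 := integrable_EFinZl (w tu * sig) highi.
have i4 := integrable_EFinB i1 i2.
rewrite RintegralD// RintegralB// !RintegralZl//.
by rewrite -(mulrA (w tl)) -(mulrA (w tu)) beta_low sigma_high; ring.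
Qed.

Lemma Rintegral_weighted_ghat1 :
  \int[mu]_x (w (lam x) * gh1 x) =
  \int[mu]_x (w (lam x) * f1 x) + (w tl - w tu) * eps1.
Proof.
transitivity (\int[mu]_x (w (lam x) * f1 x + (w tl * (1 - bet * tl)) * low x -
    (w tu * (1 - sig * tu)) * high x)).
  apply: eq_Rintegral => x _; rewrite ghat1E.
  have := clipped_low tl_gt0 tltu (f0_ge0 x) (f1_ge0 x) w.
  have := clipped_high tl_gt0 tltu (f0_ge0 x) (f1_ge0 x) w.
  by move=> eh el; rewrite mulrBr mulrDr !(mulrCA _ (1 - _)) eh el; ring.
have i1 := wi f1i; have i2 := integrable_EFinZl (w tl * (1 - bet * tl)) lowi.
have i3 := integrable_EFinZl (w tu * (1 - sig * tu)) highi.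
have i4 := integrable_EFinD i1 i2.
rewrite RintegralB// RintegralD// !RintegralZl//.
(* By [beta_low] and [int_low] the factor next to [w tl] is [eps1 + tl * eps0 - tl * eps0]. *)
have -> : w tl * (1 - bet * tl) * (\int[mu]_x low x) = w tl * eps1.
  by rewrite -mulrA mulrBl mul1r (mulrAC bet) beta_low int_low; ring.
have -> : w tu * (1 - sig * tu) * (\int[mu]_x high x) = w tu * eps1.
  by rewrite -mulrA mulrBl mul1r (mulrAC sig) sigma_high int_high; ring.
ring.
Qed.

End weighted.

Lemma ghat0_Rintegral : \int[mu]_x gh0 x = 1.
Proof.
have w1 g : \int[mu]_x (cst 1 (lam x) * g x) = \int[mu]_x g x.
  by apply: eq_Rintegral => x _; rewrite mul1r.
rewrite -w1 (@Rintegral_weighted_ghat0 _ 1)//; last by move=> x; rewrite normr1.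
by rewrite w1 (is_density_Rintegral Ff0) subrr mul0r addr0.
Qed.

Lemma ghat1_Rintegral : \int[mu]_x gh1 x = 1.
Proof.
have w1 g : \int[mu]_x (cst 1 (lam x) * g x) = \int[mu]_x g x.
  by apply: eq_Rintegral => x _; rewrite mul1r.
rewrite -w1 (@Rintegral_weighted_ghat1 _ 1)//; last by move=> x; rewrite normr1.
by rewrite w1 (is_density_Rintegral Ff1) subrr mul0r addr0.
Qed.

Lemma dist_ghat0 : \int[mu]_x `|gh0 x - f0 x| <= 2 * eps0.
Proof.
have i1 := integrable_EFinZl bet lowi; have i2 := integrable_EFinZl sig highi.
have -> : 2 * eps0 = \int[mu]_x (bet * low x + sig * high x).
  by rewrite RintegralD// !RintegralZl// beta_low sigma_high; ring.
apply: le_Rintegral => //; [exact/integrable_norm/integrable_EFinB|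
  exact: integrable_EFinD|].
move=> x _; rewrite ghat0E ler_norml.
have : 0 <= bet * low x by rewrite mulr_ge0// le_max lexx orbT.
have : 0 <= sig * high x by rewrite mulr_ge0// le_max lexx orbT.
lra.
Qed.

Lemma dist_ghat1 : \int[mu]_x `|gh1 x - f1 x| <= 2 * eps1.
Proof.
have i1 := integrable_EFinZl (1 - bet * tl) lowi.
have i2 := integrable_EFinZl (1 - sig * tu) highi.
have -> : 2 * eps1 =
    \int[mu]_x ((1 - bet * tl) * low x + (1 - sig * tu) * high x).
  rewrite RintegralD// !RintegralZl// !mulrBl !mul1r (mulrAC bet) (mulrAC sig).
  by rewrite beta_low sigma_high int_low int_high; ring.
apply: le_Rintegral => //; [exact/integrable_norm/integrable_EFinB|
  exact: integrable_EFinD|].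
move=> x _; rewrite ghat1E ler_norml.
have : 0 <= (1 - bet * tl) * low x by rewrite mulr_ge0// le_max lexx orbT.
have : 0 <= (1 - sig * tu) * high x by rewrite mulr_ge0// le_max lexx orbT.
lra.
Qed.


(** * Powers of the clipped ratio as weights, and the maximum of [D_] *)

Let mlam_powR u : measurable_fun setT (fun x => lam x `^ u).
Proof. exact: (measurableT_comp (@measurable_powR R u) measurable_clipped). Qed.

Lemma clipped_powR_itv (u : R) x : 0 <= u -> tl `^ u <= lam x `^ u <= tu `^ u.
Proof.
move=> u0; have /andP[h1 h2] := lam_itv x.
by apply/andP; split; apply: ge0_ler_powR; rewrite ?nnegrE// ltW.
Qed.

Lemma clipped_powRB1_itv (u : R) x : u <= 1 ->
  tu `^ (u - 1) <= lam x `^ (u - 1) <= tl `^ (u - 1).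
Proof.
rewrite -subr_ge0 => /(@clipped_powR_itv _ x) /andP[h1 h2].
by rewrite -opprB !powRN !lef_pV2 ?posrE ?powR_gt0// h1 h2.
Qed.

Let lam_powRi (u : R) g : 0 <= u -> mu.-integrable setT (EFin \o g) ->
  mu.-integrable setT (EFin \o (fun x => lam x `^ u * g x)).
Proof.
move=> u0 gi; apply: (integrable_EFinMl (M := tu `^ u) _ _ gi) => // x.
by rewrite ger0_norm ?powR_ge0//; have /andP[] := clipped_powR_itv x u0.
Qed.

Let lam_powRB1_bound u x : u <= 1 -> `|lam x `^ (u - 1)| <= tl `^ (u - 1).
Proof.
by move=> u1; rewrite ger0_norm ?powR_ge0//; have /andP[] := clipped_powRB1_itv x u1.
Qed.

Let lam_powRB1i u g : u <= 1 -> mu.-integrable setT (EFin \o g) ->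
  mu.-integrable setT (EFin \o (fun x => lam x `^ (u - 1) * g x)).
Proof.
move=> u1 gi; apply: (integrable_EFinMl (M := tl `^ (u - 1)) _ _ gi) => // x.
exact: lam_powRB1_bound.
Qed.

(** For [0 < u < 1] this is [D_] at the pair, since [gh1 = lam * gh0]. The formula extends to
    [u = 0] and [u = 1], where it gives the masses of [gh0] and [gh1]. *)
Definition ghat_affinity (u : R) : R := \int[mu]_x (lam x `^ u * gh0 x).
Local Notation h := ghat_affinity.

Lemma mean_ghat (u : R) : 0 < u -> 
  (1 - u) * \int[mu]_x (lam x `^ u * gh0 x) +
    u * \int[mu]_x (lam x `^ (u - 1) * gh1 x) = h u.
Proof.
move=> u0; rewrite [X in _ + u * X](_ : _ = h u); first by rewrite /h; ring.
apply: eq_Rintegral => x _; rewrite ghat1_clipped mulrA; congr (_ * _).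
by rewrite mulrC mulr_powRB1// ltW.
Qed.

(** The weight [lam]^ u[increases with]lam[and]lam [^ (u - 1)] decreases, so the pair attains the
    largest value that the neighborhoods allow for each of the two linear terms. *)
Lemma mean_tv_nbhd_le (u : R) G0 G1 g0 g1 : 0 < u < 1 ->
  tv_nbhd mu F0 eps0 G0 -> tv_nbhd mu F1 eps1 G1 ->
  is_density mu G0 g0 -> is_density mu G1 g1 ->
  \int[mu]_x ((1 - u) * (lam x `^ u * g0 x) + u * (lam x `^ (u - 1) * g1 x))
    <= h u.
Proof.
move=> /andP[u0 u1] N0 N1 Gg0 Gg1.
have g0i := is_density_integrable Gg0; have g1i := is_density_integrable Gg1.
have i0 := lam_powRi (ltW u0) g0i; have i1 := lam_powRB1i (ltW u1) g1i.
rewrite RintegralD//; [|exact: integrable_EFinZl|exact: integrable_EFinZl].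
rewrite !RintegralZl// -mean_ghat//.
apply: lerD; rewrite ler_wpM2l ?subr_ge0 ?(ltW u0) ?(ltW u1)//.
- rewrite (Rintegral_weighted_ghat0 (w := @powR R ^~ u) (M := tu `^ u))//; last first.
    by move=> x; rewrite ger0_norm ?powR_ge0//;
      have /andP[] := clipped_powR_itv x (ltW u0).
  apply: (tv_nbhd_weighted_le Gg0 Ff0 N0 (mlam_powR u)) => x.
  exact: clipped_powR_itv (ltW u0).
- rewrite (Rintegral_weighted_ghat1 (w := @powR R ^~ (u - 1)) (M := tl `^ (u - 1)))//;
    last by move=> x; exact: lam_powRB1_bound (ltW u1).
  apply: (tv_nbhd_weighted_le Gg1 Ff1 N1 (mlam_powR (u - 1))) => x.
  exact: clipped_powRB1_itv (ltW u1).
Qed.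

Let powR_lam u a b x := @powR_tangent R (lam x) u a b (lam_gt0 x).

(** [gh1 = lam * gh0] is the equality case of [powR_tangent] at every point. *)
Lemma D_ghat (u : R) G0 G1 : 0 < u < 1 -> is_density mu G0 gh0 ->
  is_density mu G1 gh1 -> D_ mu u G0 G1 = (h u)%:E.
Proof.
move=> u01 Gg0 Gg1; have /andP[u0 u1] := u01.
rewrite (D_Rintegral u01 Gg0 Gg1) -mean_ghat//; congr EFin.
have i0 := lam_powRi (ltW u0) ghat0i; have i1 := lam_powRB1i (ltW u1) ghat1i.
rewrite -!RintegralZl// -RintegralD//;
  [|exact: integrable_EFinZl|exact: integrable_EFinZl].
apply: eq_Rintegral => x _; apply/eqP.
by rewrite (powR_lam _ u01 (ghat0_ge0 x) (ghat1_ge0 x)) ghat1_clipped.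
Qed.

Lemma D_tv_nbhd_le (u : R) G0 G1 : 0 < u < 1 ->
  tv_nbhd mu F0 eps0 G0 -> tv_nbhd mu F1 eps1 G1 -> (D_ mu u G0 G1 <= (h u)%:E)%E.
Proof.
move=> u01 N0 N1; have /andP[u0 u1] := u01.
have [[g0 Gg0] _] := N0; have [[g1 Gg1] _] := N1.
rewrite (D_Rintegral u01 Gg0 Gg1) lee_fin.
rewrite (le_trans _ (mean_tv_nbhd_le u01 N0 N1 Gg0 Gg1))//.
have g0i := is_density_integrable Gg0; have g1i := is_density_integrable Gg1.
have g0_ge0 x : 0 <= g0 x by case: Gg0.
have g1_ge0 x : 0 <= g1 x by case: Gg1.
apply: le_Rintegral => //; first exact: integrable_powR_mean.
  by apply/integrable_EFinD; apply/integrable_EFinZl;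
    [apply: lam_powRi|apply: lam_powRB1i] => //; exact: ltW.
by move=> x _; rewrite (powR_lam x u01 (g0_ge0 x) (g1_ge0 x)).
Qed.

Lemma exists_ghat_prob : exists G0 G1 : probability T R,
  [/\ is_density mu G0 gh0, is_density mu G1 gh1,
      tv_nbhd mu F0 eps0 G0 & tv_nbhd mu F1 eps1 G1].
Proof.
have [G0 Gg0] := exists_density_prob ghat0i ghat0_ge0 ghat0_Rintegral.
have [G1 Gg1] := exists_density_prob ghat1i ghat1_ge0 ghat1_Rintegral.
exists G0, G1; split => //.
- exact/(tv_nbhdP _ Gg0 Ff0)/dist_ghat0.
- exact/(tv_nbhdP _ Gg1 Ff1)/dist_ghat1.
Qed.

(** * Minimization over [u], and the likelihood ratio of every least favorable pair *)

Local Notation N0 := (tv_nbhd mu F0 eps0).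
Local Notation N1 := (tv_nbhd mu F1 eps1).

Lemma max_D_ghat (u : R) : 0 < u < 1 -> max_D mu N0 N1 u = (h u)%:E.
Proof.
move=> u01; have [G0 [G1 [Gg0 Gg1 NG0 NG1]]] := exists_ghat_prob.
apply/eqP; rewrite eq_le; apply/andP; split.
  by apply: ge_ereal_sup => _ [[H0 H1] [/= NH0 NH1] <-]; exact: D_tv_nbhd_le.
by rewrite -(D_ghat u01 Gg0 Gg1); apply: ereal_sup_ubound; exists (G0, G1).
Qed.

Lemma exists_minimizing : exists u, minimizing mu N0 N1 u.
Proof.
suff [u u01 hu] : exists2 u : R, 0 < u < 1 & forall v : R, 0 < v < 1 -> h u <= h v.
  exists u; split=> [//|v v01].
  by rewrite (max_D_ghat u01) (max_D_ghat v01) lee_fin hu.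
have h0 : h 0 = 1.
  rewrite -[RHS]ghat0_Rintegral; apply: eq_Rintegral => x _.
  by rewrite powRr0 mul1r.
have h1 : h 1 = 1.
  rewrite -[RHS]ghat1_Rintegral; apply: eq_Rintegral => x _.
  by rewrite powRr1 ?ghat1_clipped// ltW.
have hle (u : R) : 0 < u < 1 -> h u <= 1.
  move=> u01; have /andP[u0 u1] := u01.
  have <- : \int[mu]_x ((1 - u) * gh0 x + u * gh1 x) = 1.
    rewrite RintegralD//; [|exact: integrable_EFinZl|exact: integrable_EFinZl].
    by rewrite !RintegralZl// ghat0_Rintegral ghat1_Rintegral; ring.
  apply: le_Rintegral => //; first exact: lam_powRi (ltW u0) ghat0i.
    by apply: integrable_EFinD; exact: integrable_EFinZl.
  move=> x _.
  have [+ _] := powR_tangent (@ltr01 R) u01 (ghat0_ge0 x) (ghat1_ge0 x).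
  rewrite !powR1 !mul1r ghat1_clipped powRM ?ghat0_ge0 ?(ltW (lam_gt0 x))//.
  rewrite -mulrA -powRD ?subrKC ?oner_eq0// powRr1 ?ghat0_ge0//.
(* The bound of [lerB_powR] on [[tl, tu]] is integrated against [gh0], which has mass 1. *)
have hK : forall u v : R, `[0, 1]%classic u -> `[0, 1]%classic v ->
    `|h u - h v| <= (tu * (ln tu - ln tl)) * `|u - v|.
  move=> u v; rewrite /= !in_itv/= => u01 v01.
  have /andP[u0 _] := u01; have /andP[v0 _] := v01.
  set K := tu * _; rewrite -[leRHS]mulr1 -[X in _ * X]ghat0_Rintegral -RintegralZl//.
  apply: le_dist_Rintegral; [exact: lam_powRi|exact: lam_powRi|
    exact: integrable_EFinZl|].
  move=> x; rewrite -mulrBl normrM (ger0_norm (ghat0_ge0 x)).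
  rewrite ler_wpM2r ?ghat0_ge0//; have /andP[l1 l2] := lam_itv x.
  by apply: lerB_powR => //; [rewrite tl_gt0|exact: ltW|exact: ltW].
have [c] := EVT_min ler01 (lipschitz_within_continuous hK).
rewrite in_itv/= => /andP[c0 c1] hc.
have {}hc (v : R) : 0 < v < 1 -> h c <= h v.
  by move=> /andP[v0 v1]; apply: hc; rewrite in_itv/= !ltW.
have half01 : 0 < (2^-1 : R) < 1 by rewrite invr_gt0 ltr0n invf_lt1 ?ltr1n.
(* A minimum value 1 forces [h = 1] on the whole open interval, so [2^-1] serves as well; otherwise
   the minimizer differs from both end points, where [h] is 1. *)
have [hc1|hc1] := eqVneq (h c) 1.
  exists 2^-1 => [//|v v01]; apply: le_trans (hc v v01).
  by rewrite hc1 hle.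
exists c => //; rewrite !lt_neqAle c0 c1 !andbT.
by apply/andP; split; apply: contraNneq hc1; [move=> <-; rewrite h0|move=> ->; rewrite h1].
Qed.

Lemma exists_least_favorable : exists G0 G1 : probability T R,
  [/\ least_favorable mu N0 N1 G0 G1, is_density mu G0 gh0 & is_density mu G1 gh1].
Proof.
have [G0 [G1 [Gg0 Gg1 NG0 NG1]]] := exists_ghat_prob.
have [u mu_u] := exists_minimizing; have [u01 _] := mu_u.
exists G0, G1; split; [exists u; split|exact: Gg0|exact: Gg1].
- exact: mu_u.
- exact: NG0.
- exact: NG1.
move=> H0 H1 NH0 NH1.
by rewrite (D_ghat u01 Gg0 Gg1); exact: D_tv_nbhd_le.
Qed.

(** A maximizing pair has [D_] at least [h u], while its tangent bound integrates to at most [h u].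
    The nonnegative gap in AM-GM therefore vanishes almost everywhere, and equality means
    [g1 = lam * g0]. *)
Lemma least_favorable_lratio (G0 G1 : probability T R) (g0 g1 : T -> R) :
  least_favorable mu N0 N1 G0 G1 -> is_density mu G0 g0 -> is_density mu G1 g1 ->
  {ae mu, forall x, g0 x != 0 \/ g1 x != 0 ->
    lratio g0 g1 x = clip tl tu (lratio f0 f1 x)}.
Proof.
move=> [u [[u01 _] NG0 NG1 Gmax]] Gg0 Gg1; have /andP[u0 u1] := u01.
have [H0 [H1 [Hh0 Hh1 NH0 NH1]]] := exists_ghat_prob.
have := Gmax _ _ NH0 NH1.
rewrite (D_ghat u01 Hh0 Hh1) (D_Rintegral u01 Gg0 Gg1) lee_fin => hle.
have g0i := is_density_integrable Gg0; have g1i := is_density_integrable Gg1.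
have g0_ge0 x : 0 <= g0 x by case: Gg0.
have g1_ge0 x : 0 <= g1 x by case: Gg1.
have i0 := integrable_EFinZl (1 - u) (lam_powRi (ltW u0) g0i).
have i1 := integrable_EFinZl u (lam_powRB1i (ltW u1) g1i).
have i01 := integrable_EFinD i0 i1.
have ig := integrable_powR_mean u01 g0_ge0 g1_ge0 g0i g1i.
have := Rintegral_eq0_ae (integrable_EFinB i01 ig).
case=> [x||].
- by rewrite subr_ge0 (powR_lam x u01 (g0_ge0 x) (g1_ge0 x)).
- rewrite RintegralB// subr_le0 (le_trans _ hle)//.
  exact: (mean_tv_nbhd_le u01 NG0 NG1 Gg0 Gg1).
move=> N [mN muN0 sN]; exists N; split => // x /=; apply: contra_notP => nN.
have /eqP : (1 - u) * (lam x `^ u * g0 x) + u * (lam x `^ (u - 1) * g1 x) -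
    g1 x `^ u * g0 x `^ (1 - u) = 0.
  by apply: contrapT => xN; apply: nN; apply: sN.
rewrite subr_eq0 eq_sym (powR_lam x u01 (g0_ge0 x) (g1_ge0 x)) => /eqP g1E.
(* A zero of [g0] would be a zero of [g1 = lam * g0] too, which [g01] excludes; hence the quotient
   is an ordinary real one. *)
move=> g01; have g0x : 0 < g0 x.
  rewrite lt_def g0_ge0 andbT; apply/eqP => g0x.
  by case: g01; rewrite ?g1E g0x ?mulr0 eqxx.
rewrite lratio_gt0// (fine_clip_lratio tl_gt0 tltu)//.
by rewrite g1E mulfK// gt_eqF.
Qed.

End least_favorable_pair.

Unset Implicit Arguments.
Set Strict Implicit.

Theorem mainTheorem3 (d : measure_display) (T : measurableType d) (R : realType)
    (mu : {measure set T -> \bar R}) (F0 F1 : probability T R)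
    (f0 f1 : T -> R) (eps0 eps1 : R) :
  is_density mu F0 f0 -> is_density mu F1 f1 ->
  0 < eps0 -> 0 < eps1 ->
  tv_nbhd mu F0 eps0 `&` tv_nbhd mu F1 eps1 = set0 ->
  let LFD := least_favorable mu (tv_nbhd mu F0 eps0) (tv_nbhd mu F1 eps1) in
  exists tl tu : R, [/\ 0 < tl, tl < tu,
    (exists G0 G1 : probability T R, [/\ LFD G0 G1,
       is_density mu G0 (ghat0 mu f0 f1 eps0 tl tu) &
       is_density mu G1 (ghat1 mu f0 f1 eps0 tl tu)]) &
    (forall (G0 G1 : probability T R) (g0 g1 : T -> R),
       LFD G0 G1 -> is_density mu G0 g0 -> is_density mu G1 g1 ->
       {ae mu, forall x, g0 x != 0 \/ g1 x != 0 ->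
         lratio g0 g1 x = clip tl tu (lratio f0 f1 x)})].
Proof.
move=> Ff0 Ff1 e0 e1 /(disjoint_tv_nbhd_dist Ff0 Ff1 e0 e1) far LFD.
have [tl /andP[tl0 tl1] int_low] := exists_lower_threshold Ff0 Ff1 e0 e1 far.
have [tu tu1 int_high] := exists_upper_threshold Ff0 Ff1 e0 e1 far.
exists tl, tu; split=> [//||| G0 G1 g0 g1].
- exact: lt_trans tu1.
- exact: (exists_least_favorable Ff0 Ff1 e0 e1 tl0 tl1 tu1 int_low int_high).
- exact: (least_favorable_lratio Ff0 Ff1 e0 e1 tl0 tl1 tu1 int_low int_high).
Qed.
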